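(* Let $(X,G)$ be a $G$-metric space, let $m\ge 1$, let $X_1,\dots,X_m$ be nonempty subsets of $X$, and let $T:\bigcup_{i=1}^m X_i\to\bigcup_{i=1}^m X_i$ be a G-Chatterjea cyclical operator. Then for every $\epsilon>0$, $T$ has an $\epsilon$-fixed point.
   Context: A $G$-metric on a nonempty set $X$ is a function $G:X\times X\times X\to[0,\infty)$ such that: (G1) $G(x,y,z)=0$ if and only if $x=y=z$; (G2) $0<G(x,x,y)$ for all $x,y\in X$ with $x\neq y$; (G3) $G(x,x,y)\le G(x,y,z)$ for all $x,y,z\in X$ with $z\ne y$; (G4) $G$ is symmetric in its three variables (invariant under all permutations of its arguments); (G5) $G(x,y,z)\le G(x,a,a)+G(a,y,z)$ for all $x,y,z,a\in X$. The pair $(X,G)$ is called a $G$-metric space (completeness is not assumed). With the convention $X_{m+1}=X_1$, a map $T:\bigcup_{i=1}^m X_i\to\bigcup_{i=1}^m X_i$ is a cyclical operator if $T(X_i)\subseteq X_{i+1}$ for all $i=1,\dots,m$. A G-Chatterjea cyclical operator is a cyclical operator $T$ for which there exists $\alpha\in(0,\frac12)$ such that for all $i\in\{1,\dots,m\}$, $x\in X_i$, $y\in X_{i+1}$, $$G(Tx,Ty,Ty)+G(Ty,Tx,Tx)\le \alpha\,[G(x,Ty,Ty)+G(Ty,x,x)+G(y,Tx,Tx)+G(Tx,y,y)].$$ For $\epsilon>0$, a point $x_0\in\bigcup_{i=1}^m X_i$ is an $\epsilon$-fixed point of $T$ if $G(x_0,Tx_0,Tx_0)+G(Tx_0,x_0,x_0)<\epsilon$.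 *)

(* Defs.v *)
From mathcomp Require Import all_boot all_order all_algebra.
From mathcomp Require Import boolp classical_sets reals.

Set Implicit Arguments.
Unset Strict Implicit.
Unset Printing Implicit Defensive.

Import Order.TTheory GRing.Theory Num.Theory.
Local Open Scope classical_set_scope.
Local Open Scope ring_scope.

Record is_Gmetric (R : realType) (X : Type) (G : X -> X -> X -> R) : Prop := {
  Gmetric_carrier : [set: X] !=set0 ;
  Gmetric_ge0 : forall x y z, 0 <= G x y z ;
  Gmetric_eq0 : forall x y z, G x y z = 0 <-> x = y /\ y = z ;
  Gmetric_gt0 : forall x y, x <> y -> 0 < G x x y ;
  Gmetric_le : forall x y z, z <> y -> G x x y <= G x y z ;
  Gmetric_sym : forall x y z,
    [/\ G x y z = G x z y, G x y z = G y x z, G x y z = G y z x,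
        G x y z = G z x y & G x y z = G z y x] ;
  Gmetric_triangle : forall x y z a, G x y z <= G x a a + G a y z
}.

(* The sets X_1, ..., X_m are indexed by 'I_m, and the successor i + 1, with
   m + 1 read as 1, is ordS i.  An operator on their union is a function on
   the subtype of the points of the union. *)
Definition cyclical_operator (X : Type) (m : nat) (X_ : 'I_m -> set X)
    (T : \bigcup_i X_ i -> \bigcup_i X_ i) : Prop :=
  forall (i : 'I_m) (x : \bigcup_i X_ i),
    X_ i (val x) -> X_ (ordS i) (val (T x)).

Definition G_Chatterjea_cyclical_operator (R : realType) (X : Type)
    (G : X -> X -> X -> R) (m : nat) (X_ : 'I_m -> set X)
    (T : \bigcup_i X_ i -> \bigcup_i X_ i) : Prop :=
  cyclical_operator T /\
  exists alpha : R, 0 < alpha < 1 / 2 /\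
    forall (i : 'I_m) (x y : \bigcup_i X_ i),
      X_ i (val x) -> X_ (ordS i) (val y) ->
      G (val (T x)) (val (T y)) (val (T y)) +
        G (val (T y)) (val (T x)) (val (T x))
      <= alpha * (G (val x) (val (T y)) (val (T y)) +
                  G (val (T y)) (val x) (val x) +
                  G (val y) (val (T x)) (val (T x)) +
                  G (val (T x)) (val y) (val y)).

Definition eps_fixed_point (R : realType) (X : Type) (G : X -> X -> X -> R)
    (m : nat) (X_ : 'I_m -> set X) (T : \bigcup_i X_ i -> \bigcup_i X_ i)
    (eps : R) (x0 : \bigcup_i X_ i) : Prop :=
  G (val x0) (val (T x0)) (val (T x0)) + G (val (T x0)) (val x0) (val x0) < eps.

(* Main.v *)
Require Import Defs.
From mathcomp Require Import all_boot all_order all_algebra.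
From mathcomp Require Import boolp classical_sets reals.
From mathcomp Require Import lra.

Set Implicit Arguments.
Unset Strict Implicit.
Unset Printing Implicit Defensive.

Import Order.TTheory GRing.Theory Num.Theory.
Local Open Scope classical_set_scope.
Local Open Scope ring_scope.

(** The symmetrization [d x y = G x y y + G y x x] of a G-metric satisfies
    the triangle inequality and vanishes on the diagonal, and in terms of [d]
    the hypothesis on [T] is the classical Chatterjea condition
    [d (T x) (T y) <= alpha * (d x (T y) + d y (T x))].  Since [T] is cyclical,
    [y = T x] is an admissible choice for every [x] of the union; it gives
    [d (T x) (T (T x)) <= alpha * d x (T (T x))
                       <= alpha * (d x (T x) + d (T x) (T (T x)))],
    so that the displacement [x |-> d x (T x)] shrinks by the factor
    [k = alpha / (1 - alpha) < 1] each time [T] is applied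
    ([Chatterjea_displacement]).  The infimum [s] of the displacement then
    satisfies [s <= k * s], hence [s <= 0] ([contracted_arbitrarily_small]), and
    the points where the displacement is within [eps] of its infimum are
    [eps]-fixed points. *)

(** Arguing on the infimum of [f] replaces the iteration of [T] and the
    convergence of [k ^+ n] to [0]: every [f x] dominates [f (T x) / k], hence
    [inf f / k], so [inf f / k <= inf f]. *)
Lemma contracted_arbitrarily_small (R : realType) (P : Type) (T : P -> P)
    (f : P -> R) (k : R) (p : P) :
  0 < k < 1 -> (forall x, 0 <= f x) -> (forall x, f (T x) <= k * f x) ->
  forall eps : R, 0 < eps -> exists x, f x < eps.
Proof.
move=> /andP[k_gt0 k_lt1] f_ge0 fT eps eps_gt0.
have range0 : range f !=set0 by exists (f p), p.
have lb0 : lbound (range f) 0 by move=> _ [x _ <-].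
have range_inf : has_inf (range f) by split=> //; exists 0.
have inf_lb x : inf (range f) <= f x.
  by apply: ge_inf; [exists 0 | exists x].
have inf_contracted : inf (range f) / k <= inf (range f).
  apply: lb_le_inf => // _ [x _ <-]; rewrite ler_pdivrMr // mulrC.
  exact: le_trans (inf_lb (T x)) (fT x).
have inf_le0 : inf (range f) <= 0.
  by move: inf_contracted; rewrite ler_pdivrMr //; nra.
have [_ [x _ <-] fx_lt] := inf_adherent eps_gt0 range_inf.
by exists x; lra.
Qed.

Definition Gdist (R : realType) (X : Type) (G : X -> X -> X -> R) (x y : X) : R :=
  G x y y + G y x x.

Section Gdist.
Variables (R : realType) (X : Type) (G : X -> X -> X -> R).
Hypothesis hG : is_Gmetric G.

Lemma Gdist_ge0 x y : 0 <= Gdist G x y.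
Proof. by apply: addr_ge0; exact: (Gmetric_ge0 hG). Qed.

Lemma Gdistxx x : Gdist G x x = 0.
Proof.
by have Gx : G x x x = 0 by [apply/(Gmetric_eq0 hG)]; rewrite /Gdist Gx addr0.
Qed.

(** Both summands obey an oriented triangle inequality, the instance of the
    rectangle inequality of [G] with its last two arguments equal. *)
Lemma Gdist_triangle y x z : Gdist G x z <= Gdist G x y + Gdist G y z.
Proof.
have := Gmetric_triangle hG x z z y; have := Gmetric_triangle hG z x x y.
rewrite /Gdist; lra.
Qed.

Variables (m : nat) (X_ : 'I_m -> set X) (T : \bigcup_i X_ i -> \bigcup_i X_ i).

(** Taking [y = T x] in the Chatterjea condition kills the term
    [Gdist (T x) (T x)] on the right; the triangle inequality through [T x]
    bounds the other one, and the condition [alpha < 1 / 2] is exactly what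
    makes [alpha / (1 - alpha)] smaller than [1]. *)
Lemma Chatterjea_displacement : G_Chatterjea_cyclical_operator G T ->
  exists2 k : R, 0 < k < 1 &
    forall x, Gdist G (val (T x)) (val (T (T x))) <=
              k * Gdist G (val x) (val (T x)).
Proof.
move=> [cyclT [alpha [/andP[alpha_gt0 alpha_lt] chatT]]].
have alphaC_gt0 : 0 < 1 - alpha by lra.
exists (alpha / (1 - alpha)).
  by rewrite divr_gt0 //= ltr_pdivrMr //; lra.
move=> x; have [i _ Xix] := set_mem (valP x).
have chat : Gdist G (val (T x)) (val (T (T x))) <=
            alpha * Gdist G (val x) (val (T (T x))).
  have := chatT i x (T x) Xix (cyclT i x Xix).
  have := Gdistxx (val (T x)); rewrite /Gdist => Txx.
  by rewrite -addrA Txx addr0.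
have tri := Gdist_triangle (val (T x)) (val x) (val (T (T x))).
by rewrite mulrAC ler_pdivlMr //; nra.
Qed.

End Gdist.

Theorem theorem2p4 (R : realType) (X : Type) (G : X -> X -> X -> R)
    (hG : is_Gmetric G) (m : nat) (hm : (1 <= m)%N) (X_ : 'I_m -> set X)
    (hX : forall i : 'I_m, X_ i !=set0)
    (T : \bigcup_i X_ i -> \bigcup_i X_ i)
    (hT : G_Chatterjea_cyclical_operator G T) :
  forall eps : R, 0 < eps ->
    exists x0 : \bigcup_i X_ i, eps_fixed_point G T eps x0.
Proof.
have [k k01 contr] := Chatterjea_displacement hG hT.
have [x Xx] := hX (Ordinal hm).
have Ux : x \in \bigcup_i X_ i by apply/mem_set; exists (Ordinal hm).
apply: (contracted_arbitrarily_small (exist _ x Ux) k01 _ contr) => y.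
exact: Gdist_ge0.
Qed.
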